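(* Let $G$ be a Garside group with Garside element $\Delta$, and let $\Delta^m$ be the minimal positive central power of $\Delta$. Then every primitive periodic element $g\in G$ is a $k$-th root of $\Delta^m$ (i.e. $g^k=\Delta^m$) for some integer $k$ with $1\le |k|\le m\Vert\Delta\Vert$.
   Context: Garside groups. In a monoid $M$, an atom is an element $a\neq 1$ such that $a=bc$ implies $b=1$ or $c=1$; $\Vert a\Vert$ is the supremum of the lengths of expressions of $a$ as products of atoms. $M$ is atomic if it is generated by its atoms and $\Vert a\Vert<\infty$ for all $a\in M$. Put $a\le_L b$ if $ac=b$ for some $c\in M$, and $a\le_R b$ if $ca=b$ for some $c\in M$. A Garside monoid is an atomic, left and right cancellative monoid $M$ such that $(M,\le_L)$ and $(M,\le_R)$ are lattices and $M$ contains a Garside element $\Delta$, i.e. an element such that for each $a\in M$, $a\le_L\Delta$ iff $a\le_R\Delta$, and the set $[1,\Delta]=\{a\in M: 1\le_L a\le_L\Delta\}$ is finite and generates $M$. A Garside group $G$ with Garside element $\Delta$ is the group of fractions of a Garside monoid $M$ with Garside element $\Delta$; $M$ is identified with its image in $G$. Some positive power of $\Delta$ is always central; $m$ is the smallest positive integer such that $\Delta^m$ is central in $G$. An element $g\in G$ is periodic if $g^k=\Delta^\ell$ for some integers $k\neq0$ and $\ell$. A nonidentity element $g\in G$ is primitive if $g=h^k$ with $h\in G$ and $k\in\mathbb Z$ implies $k=\pm1$. *)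

(* Defs.v *)
(* MathComp, with the classical layer of MathComp-Analysis for sets. *)
From HB Require Import structures.
From mathcomp Require Import all_boot order ssralg ssrint.
From mathcomp Require Import boolp classical_sets cardinality.

Set Implicit Arguments.
Unset Strict Implicit.
Unset Printing Implicit Defensive.

Local Open Scope classical_set_scope.
Local Open Scope group_scope.

Section Monoid.
Variable M : monoidType.
Implicit Types (a b c : M) (S : set M) (s : seq M).

Definition atom : set M :=
  [set a | a <> 1 /\ forall b c, a = b * c -> b = 1 \/ c = 1].

(* [s] is an expression of [a] as a product of elements of [S]; the empty
   sequence is an expression of 1. *)
Definition expression S a s :=
  (forall x, x \in s -> S x) /\ a = \prod_(x <- s) x.

Definition generates S := forall a, exists s, expression S a s.

Definition atom_lengths a : set nat :=
  [set n | exists2 s, expression atom a s & size s = n].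

(* ||a||. [supremum] on nat returns the default 0 on an empty or unbounded set;
   neither case arises in an atomic monoid, where every [atom_lengths a] is
   nonempty and bounded. *)
Definition norm a : nat := supremum 0%N (atom_lengths a).

Definition atomic :=
  generates atom /\ forall a, ubound (atom_lengths a) !=set0.

Definition leL a b := exists c, a * c = b.
Definition leR a b := exists c, c * a = b.

(* Prop-valued, since divisibility in [M] need not be decidable. *)
Record is_lattice (le : M -> M -> Prop) : Prop := IsLattice {
  lattice_refl : forall a, le a a;
  lattice_trans : forall a b c, le a b -> le b c -> le a c;
  lattice_antisym : forall a b, le a b -> le b a -> a = b;
  lattice_join : forall a b,
    exists j, [/\ le a j, le b j & forall c, le a c -> le b c -> le j c];
  lattice_meet : forall a b,
    exists i, [/\ le i a, le i b & forall c, le c a -> le c b -> le c i]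
}.

Definition intervalL a b : set M := [set c | leL a c /\ leL c b].

Record garside_element (Delta : M) : Prop := GarsideElement {
  garside_balanced : forall a, leL a Delta <-> leR a Delta;
  garside_finite : finite_set (intervalL 1 Delta);
  garside_generates : generates (intervalL 1 Delta)
}.

Record garside_monoid : Prop := GarsideMonoid {
  garside_atomic : atomic;
  garside_mulgI : right_injective (@mul M);
  garside_mulIg : left_injective (@mul M);
  garside_latticeL : is_lattice leL;
  garside_latticeR : is_lattice leR;
  garside_ex : exists Delta, garside_element Delta
}.

End Monoid.

(* [G] is the group of fractions of [M], with [iota] the embedding of [M] into
   [G]. For a Garside monoid (more generally an Ore monoid) these properties
   determine [G] and [iota] up to unique isomorphism. *)
Record group_of_fractions (M : monoidType) (G : groupType) (iota : M -> G) :
    Prop := GroupOfFractions {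
  fractions_morph : monoid_morphism iota;
  fractions_inj : injective iota;
  fractions_gen : forall g : G, exists a b : M, g = (iota a)^-1 * iota b
}.

Section Group.
Variable G : groupType.
Implicit Types (g h : G) (k l : int).

Definition expgz g k : G :=
  match k with Posz n => g ^+ n | Negz n => g ^- n.+1 end.

Definition central g := forall h, commute g h.

Definition min_central_power g (m : nat) :=
  [/\ (0 < m)%N, central (g ^+ m) &
      forall n, (0 < n)%N -> central (g ^+ n) -> (m <= n)%N].

Definition periodic (Delta g : G) :=
  exists k l, k <> 0%Z /\ expgz g k = expgz Delta l.

Definition primitive g :=
  g <> 1 /\ forall h k, g = expgz h k -> k = 1%Z \/ k = (-1)%Z.

End Group.

(* Main.v *)
(* Order G by x <= y iff x^-1 y is in M. Finite joins exist, left translations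
   preserve the order, and so does right multiplication by D = Delta.
   Let g^k = D^m with k > 0, and let h(s) be the join of all g^n D^j with
   n m + j k <= s; this set has a finite cofinal subset. Then h is nondecreasing
   and g^a h(s) D^b = h(s + a m + b k).
   If m = 0 then g h(0) = h(0), so g = 1: thus G is torsion-free, and <g, D^m> is
   cyclic for periodic g, so a primitive periodic g is a root of the central D^m.
   If m > 0, put d = gcd(k, m). By Bezout the translates of h(0) realise
   h(0) <= h(d) <= ... <= h(k) = h(0) D; equality in one step would propagate to
   all steps and give D = 1. Hence D is a product of k/d nontrivial elements of
   M, so k/d <= ||D|| and k <= d ||D|| <= m ||D||. *)
Require Import Defs.
From mathcomp Require Import all_boot order ssralg ssrint.
From mathcomp Require Import ssrnum intdiv boolp classical_sets zify.

Set Implicit Arguments.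
Unset Strict Implicit.
Unset Printing Implicit Defensive.

(** * Integer powers in a group *)

Section IntegerPowers.
Local Open Scope group_scope.
Variable G : groupType.
Implicit Types (g h : G) (k l : int).

Lemma expgz_nat g (n : nat) : expgz g n = g ^+ n.
Proof. by []. Qed.

Lemma expgzN g k : expgz g (- k)%R = (expgz g k)^-1.
Proof.
case: k => [[|n]|n] /=; [by rewrite expg0 invg1 | by [] | by rewrite invgK].
Qed.

Lemma expgzS g k : expgz g (k + 1)%R = expgz g k * g.
Proof.
case: k => n.
  by rewrite (_ : (n%:Z + 1)%R = Posz n.+1) ?expgz_nat ?expgSr //; lia.
case: n => [|n]; first by rewrite (_ : (Negz 0 + 1)%R = 0%R) //= expg1 mulVg.
rewrite (_ : (Negz n.+1 + 1)%R = Negz n); last by lia.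
by rewrite /= [in RHS]expgS invgM mulgVK.
Qed.

Lemma expgzD g k l : expgz g (k + l)%R = expgz g k * expgz g l.
Proof.
have DS j n : expgz g (j + n%:Z)%R = expgz g j * g ^+ n.
  elim: n j => [|n IHn] j; first by rewrite GRing.addr0 expg0 mulg1.
  by rewrite -addn1 PoszD GRing.addrA expgzS IHn addn1 expgSr mulgA.
case: l => n; first exact: DS.
(* [Negz n] is [-(n + 1)]; cancelling [g ^+ n.+1] reduces to natural exponents. *)
apply: (mulIg (g ^+ n.+1)); rewrite -DS -mulgA mulVg mulg1.
by congr expgz; lia.
Qed.

Lemma expgzM g k l : expgz g (k * l)%R = expgz (expgz g k) l.
Proof.
have MS j n : expgz g (j * n%:Z)%R = expgz g j ^+ n.
  elim: n => [|n IHn]; first by rewrite GRing.mulr0.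
  by rewrite -addn1 PoszD GRing.mulrDr GRing.mulr1 expgzD IHn addn1 expgSr.
case: l => n; first exact: MS.
by rewrite NegzE GRing.mulrN !expgzN MS.
Qed.

Lemma commute_expgz g h k : commute g h -> commute g (expgz h k).
Proof.
move=> gh; case: k => n; first exact: commuteX.
exact/commuteV/commuteX.
Qed.

Lemma expgzMn g h k : commute g h -> expgz (g * h) k = expgz g k * expgz h k.
Proof.
move=> gh; case: k => n /=; first exact: expgMn.
rewrite expgMn // invgM; apply: commuteV; apply: commute_sym; apply: commuteV.
exact: commuteX2.
Qed.

End IntegerPowers.

(** * Word length in atoms *)

Section Norm.
Local Open Scope group_scope.
Variable M : monoidType.

Lemma expression_cat (S : set M) a b s t :
  expression S a s -> expression S b t -> expression S (a * b) (s ++ t).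
Proof.
move=> [Ss ->] [St ->]; split; last by rewrite big_cat.
by move=> x; rewrite mem_cat => /orP[/Ss|/St].
Qed.

(** Atomicity bounds [atom_lengths a], so [norm a] is a true supremum rather than the default 0. *)
Lemma size_expression_le_norm (a : M) s :
  atomic M -> expression (@atom M) a s -> (size s <= norm a)%N.
Proof.
move=> [_ /(_ a) bounded] as_; rewrite -leEnat.
apply: ge_supremum_Nmem; first exact: nat_supremums_neq0.
by exists s.
Qed.

End Norm.

(** * The left divisibility order on the group of fractions *)

Section GroupOfFractions.
Local Open Scope classical_set_scope.
Local Open Scope group_scope.
Variables (M : monoidType) (G : groupType) (emb : M -> G).
Hypotheses (garsideM : garside_monoid M) (fracG : group_of_fractions emb).
Implicit Types (x y z g h : G) (A B : set G) (a b p : M).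

Let emb1 : emb 1 = 1 := (fractions_morph fracG).1.
Let embM : {morph emb : a b / a * b} := (fractions_morph fracG).2.
Let emb_inj : injective emb := fractions_inj fracG.

Lemma embX a n : emb (a ^+ n) = emb a ^+ n.
Proof. by elim: n => [|n IHn]; rewrite ?expg0 ?emb1 // !expgS embM IHn. Qed.

Definition gle x y := exists p, y = x * emb p.

Lemma gle_refl x : gle x x.
Proof. by exists 1; rewrite emb1 mulg1. Qed.

Lemma gle_trans y x z : gle x y -> gle y z -> gle x z.
Proof. by move=> [p ->] [q ->]; exists (p * q); rewrite embM mulgA. Qed.

Lemma gle_antisym x y : gle x y -> gle y x -> x = y.
Proof.
move=> [p ->] [q]; rewrite -mulgA -embM -[LHS]mulg1 => /mulgI.
rewrite -emb1 => /emb_inj pq1.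
(* Since [p * q = 1], the elements [p] and 1 left-divide each other, so they coincide. *)
rewrite -(_ : 1 = p) ?emb1 ?mulg1 //.
by apply: (lattice_antisym (garside_latticeL garsideM));
  [exists p; rewrite mul1g | exists q].
Qed.

Lemma gle_mul2l g x y : gle x y -> gle (g * x) (g * y).
Proof. by move=> [p ->]; exists p; rewrite mulgA. Qed.

Definition is_sup A h :=
  (forall x, A x -> gle x h) /\ forall z, (forall x, A x -> gle x z) -> gle h z.

Lemma is_sup_le A B h h' : A `<=` B -> is_sup A h -> is_sup B h' -> gle h h'.
Proof. by move=> AB [_ hP] [h'ub _]; apply: hP => x /AB /h'ub. Qed.

Lemma is_sup_unique A h h' : is_sup A h -> is_sup A h' -> h = h'.
Proof.
by move=> hs h's; apply: gle_antisym;
  [apply: (is_sup_le _ hs h's) | apply: (is_sup_le _ h's hs)].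
Qed.

(* Multiplying by a common left denominator reduces to a join in [M]; unlike for
   meets, every upper bound of two elements of [M] is itself in [M]. *)
Lemma ex_join x y : exists j, is_sup [set x; y] j.
Proof.
have [a [b ->]] := fractions_gen fracG x.
have [c [d ->]] := fractions_gen fracG y.
have [p [[u uap] [v vcp] _]] := lattice_join (garside_latticeR garsideM) a c.
have [j [[r ubj] [s vdj] j_min]] :=
  lattice_join (garside_latticeL garsideM) (u * b) (v * d).
have xE : (emb a)^-1 * emb b = (emb p)^-1 * emb (u * b).
  by rewrite -uap !embM invgM -mulgA mulKg.
have yE : (emb c)^-1 * emb d = (emb p)^-1 * emb (v * d).
  by rewrite -vcp !embM invgM -mulgA mulKg.
exists ((emb p)^-1 * emb j); rewrite xE yE; split.
  by move=> _ [->|->]; apply: gle_mul2l; [exists r | exists s];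
    rewrite -embM ?ubj ?vdj.
move=> z zub.
have [r' zE] := zub _ (or_introl erefl); have [s' zE'] := zub _ (or_intror erefl).
have ubr_vds : u * b * r' = v * d * s'.
  apply: emb_inj; rewrite (embM _ s') (embM _ r').
  by apply: (mulgI (emb p)^-1); rewrite !mulgA -zE -zE'.
have [||t jtE] := j_min (u * b * r'); [by exists r' | by exists s' |].
by exists t; rewrite zE -!mulgA -!embM jtE.
Qed.

Lemma ex_sup_seq x s : exists h, is_sup [set y | y \in x :: s] h.
Proof.
elim: s x => [|y s IHs] x.
  exists x; split; last by move=> z; apply; rewrite /= mem_seq1.
  by move=> z /=; rewrite mem_seq1 => /eqP->; apply: gle_refl.
have [h [hub hmin]] := IHs y; have [j [jub jmin]] := ex_join x h.
exists j; split=> [z | z zub].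
  rewrite /= in_cons => /orP[/eqP-> | zs]; first by apply: jub; left.
  by apply: (gle_trans (hub _ zs)); apply: jub; right.
apply: jmin => _ [->|->]; first by apply: zub; rewrite /= mem_head.
by apply: hmin => w ws; apply: zub; rewrite /= in_cons ws orbT.
Qed.

Lemma ex_sup_cofinal A x s :
  {in x :: s, forall y, A y} ->
  (forall y, A y -> exists2 z, z \in x :: s & gle y z) ->
  exists h, is_sup A h.
Proof.
move=> sA cof; have [h [hub hmin]] := ex_sup_seq x s.
exists h; split=> [y /cof[z zs yz] | z zub]; first exact: gle_trans (hub _ zs).
by apply: hmin => y /sA; apply: zub.
Qed.

(** The empty product is 1, so each nontrivial factor contributes at least one atom to the
    concatenated expression. *)
Lemma strict_chain_expression (c : nat -> G) :
  (forall i, exists2 p, p <> 1 & c i.+1 = c i * emb p) ->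
  forall n, exists w s,
    [/\ c n = c 0 * emb w, expression (@atom M) w s & (n <= size s)%N].
Proof.
move=> step; elim=> [|n [w [s [cnE ws le_n]]]].
  by exists 1, [::]; split; rewrite ?emb1 ?mulg1 //; split; rewrite ?big_nil.
have [p p1 cSE] := step n; have [[gen _] _ _ _ _ _] := garsideM.
have [t pt] := gen p; exists (w * p), (s ++ t); split.
- by rewrite cSE cnE embM mulgA.
- exact: expression_cat.
- rewrite size_cat -addn1 leq_add // lt0n; apply/eqP => /size0nil t0.
  by case: pt => _; rewrite t0 big_nil.
Qed.

(** * Compatibility of the order with the Garside element *)

Section GarsideElement.
Variable Delta : M.
Hypothesis garsideD : garside_element Delta.
Let D := emb Delta.

(** If [a * t = Delta], balancedness yields [t * t' = Delta], hence
    [a * Delta = a * t * t' = Delta * t']. *)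
Lemma mul_simple_Delta a : leL a Delta -> exists b, a * Delta = Delta * b.
Proof.
move=> [t atD].
have [t' tt'D] : leL t Delta by apply/(garside_balanced garsideD); exists a.
by exists t'; rewrite -{1}tt'D mulgA atD.
Qed.

Lemma Delta_mul_simple a : leL a Delta -> exists b, Delta * a = b * Delta.
Proof.
move=> /(garside_balanced garsideD)[t taD].
have [t' t'tD] : leR t Delta by apply/(garside_balanced garsideD); exists a.
by exists t'; rewrite -{1}t'tD -mulgA taD.
Qed.

Lemma mul_Delta a : exists b, a * Delta = Delta * b.
Proof.
have [s [simple_s ->]] := garside_generates garsideD a.
elim: s simple_s => [|x s IHs] simple_s.
  by exists 1; rewrite big_nil mul1g mulg1.
have [|b sD] := IHs; first by move=> y ys; apply: simple_s; rewrite in_cons ys orbT.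
have [|c xD] := @mul_simple_Delta x; first by case: (simple_s x (mem_head _ _)).
by exists (c * b); rewrite big_cons -mulgA sD !mulgA xD.
Qed.

Lemma Delta_mul a : exists b, Delta * a = b * Delta.
Proof.
have [s [simple_s ->]] := garside_generates garsideD a.
elim: s simple_s => [|x s IHs] simple_s.
  by exists 1; rewrite big_nil mul1g mulg1.
have [|b Ds] := IHs; first by move=> y ys; apply: simple_s; rewrite in_cons ys orbT.
have [|c Dx] := @Delta_mul_simple x; first by case: (simple_s x (mem_head _ _)).
by exists (c * b); rewrite big_cons mulgA Dx -mulgA Ds mulgA.
Qed.

(** [mul_Delta] moves [D] to the left past a factor from [M], and [Delta_mul] does the same for
    [D^-1]. *)
Lemma gle_mulr_expD k x y : gle x y -> gle (x * expgz D k) (y * expgz D k).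
Proof.
have right z w : gle z w -> gle (z * D) (w * D).
  move=> [p ->]; have [b pD] := mul_Delta p.
  by exists b; rewrite -!mulgA -!embM pD.
have left z w : gle z w -> gle (z * D^-1) (w * D^-1).
  move=> [p ->]; have [b Dp] := Delta_mul p.
  exists b; apply: (mulIg D); rewrite mulgVK -!mulgA -embM -Dp embM.
  by rewrite mulKg.
case: k => n /=.
  elim: n x y => [|n IHn] x y xy; first by rewrite expg0 !mulg1.
  by rewrite expgS !mulgA; apply/IHn/right.
rewrite -expVgn; elim: n.+1 x y => [|i IHi] x y xy; first by rewrite expg0 !mulg1.
by rewrite expgS !mulgA; apply/IHi/left.
Qed.

Lemma gle_expD x (j l : int) : (j <= l)%R -> gle (x * expgz D j) (x * expgz D l).
Proof.
move=> le_jl; exists (Delta ^+ `|(l - j)%R|).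
by rewrite embX -/D -expgz_nat -mulgA -expgzD; congr (_ * expgz _ _); lia.
Qed.

(** * Roots of powers of the Garside element *)

Section Root.
Variables (g : G) (k m : nat).
Hypotheses (k_gt0 : (0 < k)%N) (gD : g ^+ k = D ^+ m).

(* As [g ^+ k = D ^+ m], the element [g^n D^j] behaves like a translation by
   [n m + j k]; this is the set of those translating by at most [s]. *)
Definition downset (s : int) : set G :=
  [set x | exists n j : int,
    x = expgz g n * expgz D j /\ (n * m%:Z + j * k%:Z <= s)%R].

(** Reducing [n] modulo [k] only changes the exponent of [D], which can then be raised to at least
    [-m] without leaving the set; finitely many elements are thus cofinal. *)
Lemma ex_sup_downset0 : exists h, is_sup (downset 0) h.
Proof.
pose box := [seq t <- [seq (i, j) | i <- index_iota 0 k, j <- index_iota 0 m.+1]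
                | (t.1 * m <= t.2 * k)%N].
pose val_ (t : nat * nat) := expgz g (Posz t.1) * expgz D (- t.2%:Z)%R.
apply: (@ex_sup_cofinal _ (val_ (0, 0)%N) [seq val_ t | t <- box]).
  have dval t : (t.1 * m <= t.2 * k)%N -> downset 0 (val_ t).
    by move=> le_t; exists (Posz t.1), (- t.2%:Z)%R; split=> //; lia.
  move=> y; rewrite in_cons => /orP[/eqP-> | /mapP[t t_box ->]].
    exact: dval.
  by apply: dval; move: t_box; rewrite mem_filter => /andP[].
move=> _ [n [j [-> nj]]].
pose q := (n %/ Posz k)%Z; pose a := `|(n %% Posz k)%Z|%N.
have nE : n = (a%:Z + k%:Z * q)%R.
  rewrite {1}(divz_eq n (Posz k)) -/q GRing.addrC GRing.mulrC; congr (_ + _)%R.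
  by rewrite /a gez0_abs // modz_ge0; lia.
have a_k : (a < k)%N.
  have := @ltz_pmod n (Posz k); have := @modz_ge0 n (Posz k); rewrite /a; lia.
have -> : expgz g n * expgz D j = expgz g (Posz a) * expgz D (m%:Z * q + j)%R.
  by rewrite {1}nE !expgzD !expgzM !expgz_nat gD mulgA.
set j' := (_ * q + j)%R.
have aj' : (a%:Z * m%:Z + j' * k%:Z <= 0)%R.
  by move: nj; rewrite nE /j'; lia.
clearbody j'.
have j'0 : (j' <= 0)%R by nia.
(* Capping at [m] keeps the element in the set, since [a < k] gives [a * m <= m * k]. *)
pose b := minn m `|j'|%N.
have ab : (a * m <= b * k)%N.
  have [-> | bE] : b = m \/ b = `|j'|%N by rewrite /b; lia.
    by rewrite mulnC leq_mul2l ltnW ?orbT.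
  by rewrite bE; nia.
exists (val_ (a, b)); last by apply: gle_expD => /=; rewrite /b; lia.
rewrite in_cons map_f ?orbT // mem_filter ab andTb.
apply/allpairsP; exists (a, b).
by rewrite !mem_index_iota a_k ltnS geq_minl.
Qed.

(** The map [x] to [g^a x D^b] is an order automorphism carrying one downset onto the other; with
    [g] acting on the left and [D] on the right, the two need not commute. *)
Lemma is_sup_downset_translate (s a b : int) h : is_sup (downset s) h ->
  is_sup (downset (s + a * m%:Z + b * k%:Z)%R) (expgz g a * h * expgz D b).
Proof.
move=> [hub hmin]; split=> [_ [n [j [-> nj]]] | z zub].
  have -> : expgz g n * expgz D j =
    expgz g a * (expgz g (n - a)%R * expgz D (j - b)%R) * expgz D b.
    rewrite -!mulgA -expgzD !mulgA -expgzD.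
    by congr (expgz _ _ * expgz _ _); lia.
  apply/gle_mulr_expD/gle_mul2l/hub.
  by exists (n - a)%R, (j - b)%R; split=> //; lia.
have -> : z = expgz g a * (expgz g (- a)%R * z * expgz D (- b)%R) * expgz D b.
  by rewrite !expgzN -!mulgA mulVg mulg1 mulVKg.
apply/gle_mulr_expD/gle_mul2l/hmin => _ [n [j [-> nj]]].
have -> : expgz g n * expgz D j =
  expgz g (- a)%R * (expgz g (n + a)%R * expgz D (j + b)%R) * expgz D (- b)%R.
  rewrite -!mulgA -expgzD !mulgA -expgzD.
  by congr (expgz _ _ * expgz _ _); lia.
apply/gle_mulr_expD/gle_mul2l/zub.
by exists (n + a)%R, (j + b)%R; split=> //; lia.
Qed.

Lemma downset_mono s t : (s <= t)%R -> downset s `<=` downset t.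
Proof.
by move=> st x [n [j [-> nj]]]; exists n, j; split=> //; apply: Order.le_trans st.
Qed.

(** Here [g ^+ k = 1], and left multiplication by [g] shifts levels by [m = 0], so it fixes the
    supremum. *)
Lemma root_eq1 : m = 0%N -> g = 1.
Proof.
move=> m0; have [h h_sup] := ex_sup_downset0.
have := is_sup_downset_translate 1%R 0%R h_sup.
rewrite m0 (_ : (_ + _)%R = 0%R) //= expg0 expg1 mulg1 => gh_sup.
by apply: (mulIg h); rewrite mul1g; apply: is_sup_unique gh_sup h_sup.
Qed.

Lemma root_le_norm : (0 < m)%N -> Delta <> 1 -> (k <= m * norm Delta)%N.
Proof.
move=> m_gt0 D1; have [h h_sup] := ex_sup_downset0.
pose d := gcdn k m; pose q := (k %/ d)%N.
have d_gt0 : (0 < d)%N by rewrite gcdn_gt0 k_gt0.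
have kE : k = (q * d)%N by rewrite divnK // dvdn_gcdl.
have [u [v uvd]] := Bezoutz (Posz k) (Posz m).
have {uvd}uvd : (v * m%:Z + u * k%:Z = d%:Z)%R by rewrite GRing.addrC uvd.
(* By Bezout, multiplying by [g^v] on the left and [D^u] on the right raises the level by exactly
   [d]. *)
pose c (i : nat) := expgz g (v * i%:Z)%R * h * expgz D (u * i%:Z)%R.
have c_sup i : is_sup (downset (Posz (d * i))) (c i).
  have := is_sup_downset_translate (v * i%:Z)%R (u * i%:Z)%R h_sup.
  by congr is_sup; congr downset; rewrite PoszM -uvd; lia.
have c0 : c 0%N = h by rewrite /c !GRing.mulr0 /= !expg0 mul1g mulg1.
(* The level [d * q = k] is also reached from level 0 by one right factor [D]. *)
have cq : c q = h * D.
  have := is_sup_downset_translate 0%R 1%R h_sup.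
  rewrite /= expg0 expg1 mul1g; apply: is_sup_unique.
  by have := c_sup q; congr is_sup; congr downset; rewrite mulnC -kE; lia.
have cS i : c i.+1 = expgz g (v * i%:Z)%R * c 1%N * expgz D (u * i%:Z)%R.
  rewrite /c -!mulgA -expgzD !mulgA -expgzD.
  by congr (expgz _ _ * _ * expgz _ _); lia.
have strict i : exists2 p, p <> 1 & c i.+1 = c i * emb p.
  have [p cE] : gle (c i) (c i.+1).
    by apply: (is_sup_le _ (c_sup i) (c_sup i.+1)); apply: downset_mono; lia.
  (* Equality at [i] cancels to [c 1 = h], which makes [c] constant; then [h * D = h]. *)
  exists p => // p1; move: cE; rewrite p1 emb1 mulg1 cS => /mulIg/mulgI c1.
  have ch j : c j = h by elim: j => // j IHj; rewrite cS c1 -[RHS]IHj.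
  by apply/D1/emb_inj/(mulgI h); rewrite -cq ch emb1 mulg1.
have [w [s [cqE ws le_q]]] := strict_chain_expression strict q.
move: cqE ws; rewrite cq c0 => /mulgI/emb_inj <- Ds.
have le_norm :=
  leq_trans le_q (size_expression_le_norm (garside_atomic garsideM) Ds).
(* [k = d * q], where [d <= m] because [d] divides the positive [m], and [q <= norm Delta]. *)
by rewrite kE mulnC leq_mul // dvdn_leq // dvdn_gcdr.
Qed.

End Root.

Lemma Garside_torsion_free g n : (0 < n)%N -> g ^+ n = 1 -> g = 1.
Proof. by move=> n_gt0 gn; apply: (@root_eq1 g n 0). Qed.

(** If [Delta = 1], the generating interval contains only 1, so [M] and then [G] are trivial. *)
Lemma Delta_neq1 g : g <> 1 -> Delta <> 1.
Proof.
move=> g1 D1; apply: g1.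
have triv a : a = 1.
  have [s [simple_s ->]] := garside_generates garsideD a.
  rewrite big1_seq // => x /andP[_ /simple_s[_ x_D]].
  apply: (lattice_antisym (garside_latticeL garsideM)); first by rewrite -D1.
  by exists x; rewrite mul1g.
have [a [b ->]] := fractions_gen fracG g.
by rewrite (triv a) (triv b) mulVg.
Qed.

End GarsideElement.
End GroupOfFractions.

(** * Primitive elements and commuting powers *)

Section PrimitivePowers.
Local Open Scope group_scope.
Variable G : groupType.
Implicit Types g c : G.

Lemma primitive_power_commuting g c (a b : int) :
  (forall (x : G) n, (0 < n)%N -> x ^+ n = 1 -> x = 1) ->
  primitive g -> commute g c -> a <> 0%Z -> expgz g a = expgz c b ->
  exists2 k : int, k <> 0%Z & expgz g k = c.
Proof.
move=> tf [_ g_prim] gc a0 gaE.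
pose d := gcdz a b.
have d0 : d != 0%R by rewrite gcdz_eq0; apply/nandP; left; apply/eqP.
pose a' := (a %/ d)%Z; pose b' := (b %/ d)%Z.
have aE : a = (a' * d)%R by rewrite divzK // dvdz_gcdl.
have bE : b = (b' * d)%R by rewrite divzK // dvdz_gcdr.
have [u [v uvd]] := Bezoutz a b.
have uv1 : (u * a' + v * b' = 1)%R.
  apply: (GRing.mulIf d0).
  by rewrite GRing.mulrDl -!GRing.mulrA -aE -bE uvd GRing.mul1r.
(* The quotient of the two sides has [d]-th power 1, so torsion-freeness divides both exponents by
   the gcd. *)
have a'b' : expgz g a' = expgz c b'.
  apply/divg1_eq/(tf _ `|d|%N); first by rewrite absz_gt0.
  rewrite -expgz_nat gez0_abs // expgzMn.
    by rewrite -expgzN -!expgzM -aE GRing.mulNr -bE expgzN gaE mulgV.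
  apply/commuteV/commute_expgz/commute_sym/commute_expgz.
  exact: commute_sym.
have a'0 : a' <> 0%R by move=> a'0; apply: a0; rewrite aE a'0 GRing.mul0r.
(* The Bezout combination [g^v c^u] is a [b']-th root of [g], so primitivity forces [b'] to be 1 or
   -1. *)
have gE : g = expgz (expgz g v * expgz c u) b'.
  rewrite expgzMn; last by apply/commute_expgz/commute_sym/commute_expgz/commute_sym.
  rewrite -!expgzM [(u * b')%R]GRing.mulrC [expgz c _]expgzM -a'b' -expgzM -expgzD.
  by rewrite [(a' * u)%R]GRing.mulrC GRing.addrC uv1 /= expg1.
have [b'1 | b'1] := g_prim _ _ gE.
  by exists a'; rewrite // a'b' b'1 /= expg1.
exists (- a')%R; first by lia.
by rewrite expgzN a'b' b'1 /= expg1 invgK.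
Qed.

End PrimitivePowers.

Theorem theorem3p14 (M : monoidType) (G : groupType) (iota : M -> G)
    (Delta : M) (m : nat) :
  garside_monoid M -> garside_element Delta -> group_of_fractions iota ->
  min_central_power (iota Delta) m ->
  forall g : G, primitive g -> periodic (iota Delta) g ->
  exists k : int, (1 <= `|k| <= m * norm Delta)%N /\
                  expgz g k = (iota Delta ^+ m)%g.
Proof.
move=> HM HD HG [m_gt0 Dm_central _] g g_prim [a [b [a0 gaE]]].
have tf := Garside_torsion_free HM HG HD.
(* Raising [g^a = D^b] to the power [m] makes the right side the [b]-th power of the central
   [D^m]. *)
have [] := @primitive_power_commuting G g (iota Delta ^+ m)%g
  (a * m%:Z)%R b tf g_prim.
- exact/commute_sym/Dm_central.
- by lia.
- by rewrite expgzM gaE -expgzM GRing.mulrC expgzM.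
move=> k k0 gkE; exists k; split=> //; apply/andP; split; first by lia.
have D1 : Delta <> 1%g by apply: (Delta_neq1 HM HG HD (g := g)); case: g_prim.
case: k k0 gkE => n n0 gnE.
  by apply: (root_le_norm HM HG HD (g := g)) => //; lia.
(* For a negative exponent [-(n + 1)], the bound is applied to [g^-1], whose power [n + 1] is
   [D^m]. *)
by apply: (root_le_norm HM HG HD (g := g^-1%g)) => //; rewrite expVgn.
Qed.
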